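(* Every Hausdorff polynomial functor $F\colon\mathsf{Met}\to\mathsf{Met}$ has a terminal coalgebra obtained in $\omega+\omega$ steps: the limit $V_{\omega+\omega}$ (defined below) is preserved by $F$, so the canonical morphism $FV_{\omega+\omega}\to V_{\omega+\omega}$ is an isomorphism whose inverse is a terminal coalgebra; i.e. $\nu F=V_{\omega+\omega}$.
   Context: $\mathsf{Met}$ is the category of extended metric spaces and non-expanding maps. The Hausdorff functor $\mathcal{H}$ sends $X$ to the set of compact subsets of $X$ (including $\emptyset$) with the Hausdorff distance $\bar d(S,T)=\max(\sup_{x\in S}\inf_{y\in T}d(x,y),\sup_{y\in T}\inf_{x\in S}d(x,y))$, and $\mathcal{H}f(S)=f[S]$. Hausdorff polynomial functors are generated by the grammar $F ::= \mathcal{H} \mid A \mid \mathrm{Id} \mid \prod_{i\in I}F_i \mid \coprod_{i\in I}F_i \mid FF$, with $A$ ranging over all metric spaces (constant functors), $I$ arbitrary index sets, products/coproducts in $\mathsf{Met}$, and composition. Chain: $V_0=1$, $V_{n+1}=FV_n$, $v_0$ unique, $v_{n+1}=Fv_n$; $V_\omega=\lim_n V_n$ with projections $\ell_n$; $m\colon FV_\omega\to V_\omega$ unique with $\ell_{n+1}\circ m=F\ell_n$; $V_{\omega+0}=V_\omega$, $V_{\omega+n+1}=FV_{\omega+n}$ with connecting maps $F^nm$; $V_{\omega+\omega}=\lim_n V_{\omega+n}$ with projections $\bar\ell_n$; the canonical morphism $FV_{\omega+\omega}\to V_{\omega+\omega}$ is induced by the cone $F\bar\ell_n\colon FV_{\omega+\omega}\to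 V_{\omega+n+1}$. *)

(* Defs.v *)
From HB Require Import structures.
From mathcomp Require Import all_boot all_order all_algebra.
From mathcomp Require Import all_classical all_reals.
From mathcomp Require Import ereal topology.

Set Implicit Arguments.
Unset Strict Implicit.
Unset Printing Implicit Defensive.

Import Order.TTheory GRing.Theory Num.Theory.

Local Open Scope classical_set_scope.
Local Open Scope ring_scope.
Local Open Scope ereal_scope.

(* Objects of Met: extended metric spaces (possibly empty, distance +oo
   allowed), over an arbitrary model R of the reals as in MathComp-Analysis. *)
Record met (R : realType) := Met {
  met_pt :> Type;
  edist : met_pt -> met_pt -> \bar R;
  edist_ge0 : forall x y, 0 <= edist x y;
  edist_refl : forall x, edist x x = 0;
  edist_eq0 : forall x y, edist x y = 0 -> x = y;
  edist_sym : forall x y, edist x y = edist y x;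
  edist_tri : forall y x z, edist x z <= edist x y + edist y z }.

Section MetricTopology.
Context (R : realType) (X : met R).

Definition met_ball (x : X) (e : R) : set X := [set y | edist x y < e%:E].

Lemma met_ball_center x (e : R) : (0 < e)%R -> met_ball x e x.
Proof. by move=> e0; rewrite /met_ball /= edist_refl lte_fin. Qed.

Lemma met_ball_sym x y (e : R) : met_ball x e y -> met_ball y e x.
Proof. by rewrite /met_ball /= edist_sym. Qed.

Lemma met_ball_triangle x y z (e1 e2 : R) :
  met_ball x e1 y -> met_ball y e2 z -> met_ball x (e1 + e2) z.
Proof.
rewrite /met_ball /= => xy yz; apply: le_lt_trans (edist_tri y _ _) _.
by rewrite EFinD lteD.
Qed.

(* The topology of the open balls of finite positive radius, so that [compact]
   below is the notion of MathComp-Analysis. *)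
HB.instance Definition _ := gen_eqMixin (met_pt X).
HB.instance Definition _ := gen_choiceMixin (met_pt X).
HB.instance Definition _ :=
  hasNbhs.Build (met_pt X) (nbhs_ (entourage_ met_ball)).
HB.instance Definition _ := @Nbhs_isPseudoMetric.Build R (met_pt X)
  (entourage_ met_ball) erefl met_ball met_ball_center met_ball_sym
  met_ball_triangle erefl.

Lemma met_hausdorff : hausdorff_space X.
Proof.
rewrite ball_hausdorff => a b /eqP ab.
have d0 : 0 < edist a b.
  rewrite lt_neqAle edist_ge0 andbT; apply/eqP => /esym/edist_eq0.
  exact: ab.
have [r r0 rd] : exists2 r : R, (0 < r)%R & (r + r)%:E <= edist a b.
  case: (edist a b) d0 => [d|_|//]; last by exists 1%R; rewrite ?leey.
  rewrite lte_fin => d0; exists (d / 2)%R; first by rewrite divr_gt0.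
  by rewrite lee_fin -splitr.
exists (PosNum r0, PosNum r0) => /=.
apply/eqP/nonemptyPn => -[c] [ac bc].
have := met_ball_triangle ac (met_ball_sym bc).
by rewrite /met_ball /= ltNge rd.
Qed.

End MetricTopology.

Section Morphisms.
Context (R : realType).
Implicit Types X Y Z : met R.

Record met_hom X Y := Hom {
  hom_fun :> X -> Y;
  hom_nonexp : forall x y, edist (hom_fun x) (hom_fun y) <= edist x y }.

Lemma hom_ext X Y (f g : met_hom X Y) : f =1 g -> f = g.
Proof.
case: f g => [f fP] [g gP] /= /funext fg.
by subst g; congr Hom; exact: Prop_irrelevance.
Qed.

Definition idhom X : met_hom X X := @Hom X X id (fun x y => lexx _).

Definition comp_hom X Y Z (g : met_hom Y Z) (f : met_hom X Y) : met_hom X Z :=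
  @Hom X Z (g \o f)
    (fun x y => le_trans (hom_nonexp g (f x) (f y)) (hom_nonexp f x y)).

Lemma hom_continuous X Y (f : met_hom X Y) : continuous f.
Proof.
move=> x A /nbhs_ballP[e e0 eA]; apply/nbhs_ballP; exists e => // y xy.
by apply: eA; apply: le_lt_trans (hom_nonexp f x y) xy.
Qed.

Record functor := Functor {
  fobj :> met R -> met R;
  fmap : forall X Y, met_hom X Y -> met_hom (fobj X) (fobj Y);
  fmap_id : forall X, fmap (idhom X) = idhom (fobj X);
  fmap_comp : forall X Y Z (g : met_hom Y Z) (f : met_hom X Y),
    fmap (comp_hom g f) = comp_hom (fmap g) (fmap f) }.

End Morphisms.

Arguments fmap {R} F {X Y} f : rename.
Notation "g \oh f" := (comp_hom g f) (at level 50, left associativity).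


(* Suprema in [0, +oo]: adjoining 0 only matters for the empty family, whose
   ereal_sup would be -oo. *)
Definition dsup (R : realType) (A : set (\bar R)) : \bar R :=
  ereal_sup (0 |` A).

Section Dsup.
Context (R : realType).
Implicit Types A : set (\bar R).

Lemma dsup_ge0 A : 0 <= dsup A.
Proof. by apply: ereal_sup_ubound; left. Qed.

Lemma dsup_ub A : ubound A (dsup A).
Proof. by move=> x Ax; apply: ereal_sup_ubound; right. Qed.

Lemma dsup_le A (M : \bar R) : 0 <= M -> ubound A M -> dsup A <= M.
Proof. by move=> M0 AM; apply/ereal_supP => y [->//|/AM]. Qed.

Lemma dsup_eq0 A x : A x -> 0 <= x -> dsup A = 0 -> x = 0.
Proof. by move=> /dsup_ub Ax x0 A0; apply/le_anti; rewrite x0 -A0 Ax. Qed.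

End Dsup.

Section Terminal.
Context (R : realType).

Definition one_met : met R.
Proof.
by refine (@Met R unit (fun _ _ => 0) _ _ _ _ _);
  [| |case=> -[]| |move=> *; rewrite add0e].
Defined.

Definition bang (X : met R) : met_hom X one_met :=
  @Hom R X one_met (fun=> tt) (fun x y => edist_ge0 x y).

Lemma bang_unique (X : met R) (f : met_hom X one_met) : f = bang X.
Proof. by apply: hom_ext => x; case: (f x). Qed.

End Terminal.

Section Hausdorff.
Context (R : realType) (X : met R).
Implicit Types S T U : set X.

(* sup over x in S of the distance from x to T; the latter is +oo when T is
   empty. *)
Definition excess S T : \bar R :=
  dsup [set ereal_inf [set edist x y | y in T] | x in S].

Definition hausdorff_dist S T : \bar R :=
  maxe (excess S T) (excess T S).

Lemma excess_ge0 S T : 0 <= excess S T. Proof. exact: dsup_ge0. Qed.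

Lemma inf_dist_le S T x : S x ->
  ereal_inf [set edist x y | y in T] <= excess S T.
Proof. by move=> Sx; apply: dsup_ub; exists x. Qed.

Lemma excess_le S T (M : \bar R) : 0 <= M ->
  (forall x, S x -> ereal_inf [set edist x y | y in T] <= M) ->
  excess S T <= M.
Proof. by move=> M0 SM; apply: dsup_le => // _ [x /SM ? <-]. Qed.

Lemma excess_refl S : excess S S = 0.
Proof.
apply/le_anti; rewrite excess_ge0 andbT; apply: excess_le => // x Sx.
by apply: ereal_inf_lbound; exists x => //; rewrite edist_refl.
Qed.

Lemma excess_witness S T x (e : R) : S x -> (0 < e)%R ->
  excess S T \is a fin_num ->
  exists2 y, T y & edist x y < excess S T + e%:E.
Proof.
move=> Sx e0 fin.
have /ereal_inf_lt[_ [y Ty <-] xy] :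
    ereal_inf [set edist x y | y in T] < excess S T + e%:E.
  by apply: le_lt_trans (inf_dist_le T Sx) _; rewrite lteDl.
by exists y.
Qed.

Lemma excess_tri T S U : excess S U <= excess S T + excess T U.
Proof.
have [/eqP ST|STf] := boolP (excess S T == +oo).
  by rewrite ST addye ?leey// -ltNye (lt_le_trans _ (excess_ge0 _ _)).
have [/eqP TU|TUf] := boolP (excess T U == +oo).
  by rewrite TU addey ?leey// -ltNye (lt_le_trans _ (excess_ge0 _ _)).
have {}STf : excess S T \is a fin_num by rewrite ge0_fin_numE ?excess_ge0// ltey.
have {}TUf : excess T U \is a fin_num by rewrite ge0_fin_numE ?excess_ge0// ltey.
apply: excess_le => [|x Sx]; first by rewrite adde_ge0 ?excess_ge0.
apply/lee_addgt0Pr => e e0.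
have e20 : (0 < e / 2)%R by rewrite divr_gt0.
have [y Ty xy] := excess_witness Sx e20 STf.
have [z Uz yz] := excess_witness Ty e20 TUf.
apply: (@le_trans _ _ (edist x z)); first by apply: ereal_inf_lbound; exists z.
apply: le_trans (edist_tri y _ _) _.
rewrite [e]splitr EFinD addeACA; exact: leeD (ltW xy) (ltW yz).
Qed.

Lemma excess_eq0 S T : closed T -> excess S T = 0 -> S `<=` T.
Proof.
move=> clT ST0 x Sx; apply: clT => A /nbhs_ballP[e e0 eA].
have := @excess_witness S T x e Sx e0; rewrite ST0 => /(_ isT)[y Ty].
by rewrite add0e => xy; exists y; split => //; exact: eA.
Qed.

Definition compacts := {S : set X | compact S}.

Definition hausdorff_met : met R.
Proof.
refine (@Met R compacts (fun S T : compacts => hausdorff_dist (sval S) (sval T)) _ _ _ _ _).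
- by move=> S T; rewrite le_max excess_ge0.
- by move=> S; rewrite /hausdorff_dist excess_refl maxxx.
- move=> [S cS] [T cT]; rewrite /= /hausdorff_dist => m0.
  have [ST TS] : excess S T = 0 /\ excess T S = 0.
    by split; apply/le_anti; rewrite excess_ge0 -m0 le_max lexx ?orbT.
  have eqST : S = T.
    by apply/seteqP; split; apply: excess_eq0 => //;
      apply: compact_closed => //; exact: met_hausdorff.
  by subst T; congr exist; exact: Prop_irrelevance.
- by move=> S T; rewrite /hausdorff_dist maxC.
- move=> [T cT] [S cS] [U cU] /=; rewrite /hausdorff_dist ge_max.
  apply/andP; split; apply: le_trans (excess_tri T _ _) _.
    by apply: leeD; rewrite le_max lexx.
  by rewrite addeC; apply: leeD; rewrite le_max lexx orbT.
Defined.

End Hausdorff.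

Section HausdorffFunctor.
Context (R : realType).
Implicit Types X Y : met R.

Lemma compact_image X Y (f : met_hom X Y) (S : set X) :
  compact S -> compact (f @` S).
Proof.
by apply: continuous_compact; apply: continuous_subspaceT; exact: hom_continuous.
Qed.

Definition himage X Y (f : met_hom X Y) (S : hausdorff_met X) : hausdorff_met Y :=
  exist _ (f @` sval S) (compact_image (svalP S)).

Lemma excess_image X Y (f : met_hom X Y) (S T : set X) :
  excess (f @` S) (f @` T) <= excess S T.
Proof.
apply: excess_le => [|_ [x Sx <-]]; first exact: excess_ge0.
apply: le_trans (inf_dist_le T Sx); apply/ereal_infP => _ [y Ty <-].
apply: le_trans (hom_nonexp f x y); apply: ereal_inf_lbound.
by exists (f y) => //; exists y.
Qed.

Lemma himage_nonexp X Y (f : met_hom X Y) (S T : hausdorff_met X) :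
  edist (himage f S) (himage f T) <= edist S T.
Proof.
by rewrite /= /hausdorff_dist ge_max !le_max !excess_image orbT.
Qed.

Lemma compacts_eq X (S T : hausdorff_met X) : sval S = sval T -> S = T.
Proof.
case: S T => [S cS] [T cT] /= ST; subst T.
by congr exist; exact: Prop_irrelevance.
Qed.

Definition hausdorff_functor : functor R.
Proof.
refine (@Functor R (@hausdorff_met R)
  (fun X Y f => Hom (himage_nonexp f)) _ _).
- by move=> X; apply: hom_ext => S; apply: compacts_eq; rewrite /= image_id.
- move=> X Y Z g f; apply: hom_ext => S; apply: compacts_eq.
  by rewrite /= image_comp.
Defined.

End HausdorffFunctor.

Section BasicFunctors.
Context (R : realType).
Implicit Types X Y : met R.

Definition id_functor : functor R.
Proof. by refine (@Functor R id (fun _ _ f => f) _ _). Defined.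

Definition const_functor (A : met R) : functor R.
Proof.
by refine (@Functor R (fun=> A) (fun _ _ _ => idhom A) _ _) => *; exact: hom_ext.
Defined.

Definition comp_functor (F G : functor R) : functor R.
Proof.
refine (@Functor R (fun X => F (G X)) (fun _ _ f => fmap F (fmap G f)) _ _).
- by move=> X; rewrite !fmap_id.
- by move=> X Y Z g f; rewrite !fmap_comp.
Defined.

End BasicFunctors.

Section Product.
Context (R : realType) (I : Type).
Implicit Types X Y : I -> met R.

Definition prod_dist X (x y : forall i, X i) : \bar R :=
  dsup (range (fun i => edist (x i) (y i))).

Lemma prod_dist_ub X (x y : forall i, X i) i :
  edist (x i) (y i) <= prod_dist x y.
Proof. by apply: dsup_ub; exists i. Qed.

Lemma prod_dist_le X (x y : forall i, X i) (M : \bar R) : 0 <= M ->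
  (forall i, edist (x i) (y i) <= M) -> prod_dist x y <= M.
Proof. by move=> M0 xyM; apply: dsup_le => // _ [i _ <-]. Qed.

Definition prod_met X : met R.
Proof.
refine (@Met R (forall i, X i) (@prod_dist X) _ _ _ _ _).
- by move=> x y; exact: dsup_ge0.
- move=> x; apply/le_anti; rewrite dsup_ge0 andbT.
  by apply: prod_dist_le => // i; rewrite edist_refl.
- move=> x y xy0; apply: functional_extensionality_dep => i.
  by apply: edist_eq0; apply: dsup_eq0 xy0; [exists i|exact: edist_ge0].
- by move=> x y; congr dsup; congr image; apply/funext => i; rewrite edist_sym.
- move=> y x z; apply: prod_dist_le => [|i].
    by rewrite adde_ge0 ?dsup_ge0.
  by apply: le_trans (edist_tri (y i) _ _) _; rewrite leeD ?prod_dist_ub.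
Defined.

Definition prod_proj X i : met_hom (prod_met X) (X i) :=
  @Hom R (prod_met X) (X i) (fun x => x i) (fun x y => prod_dist_ub x y i).

Lemma prod_universal X (C : met R) (c : forall i, met_hom C (X i)) :
  exists! h : met_hom C (prod_met X), forall i, prod_proj X i \oh h = c i.
Proof.
have ne (x y : C) : edist ((fun i => c i x) : prod_met X) (fun i => c i y) <= edist x y.
  by apply: prod_dist_le => [|i]; [exact: edist_ge0|exact: hom_nonexp].
exists (Hom ne); split => [i|h hc]; first exact: hom_ext.
apply: hom_ext => x; apply: functional_extensionality_dep => i /=.
by rewrite -hc.
Qed.

Lemma prod_map_nonexp X Y (f : forall i, met_hom (X i) (Y i)) (x y : prod_met X) :
  edist ((fun i => f i (x i)) : prod_met Y) (fun i => f i (y i)) <= edist x y.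
Proof.
apply: prod_dist_le => [|i]; first exact: edist_ge0.
by apply: le_trans (prod_dist_ub _ _ i); exact: hom_nonexp.
Qed.

Definition prod_functor (F : I -> functor R) : functor R.
Proof.
refine (@Functor R (fun X : met R => prod_met (fun i => F i X))
  (fun (X Y : met R) (f : met_hom X Y) => Hom (prod_map_nonexp (fun i => fmap (F i) f))) _ _).
- move=> X; apply: hom_ext => x; apply: functional_extensionality_dep => i.
  by rewrite /= fmap_id.
- move=> X Y Z g f; apply: hom_ext => x.
  by apply: functional_extensionality_dep => i; rewrite /= fmap_comp.
Defined.

End Product.

Section Coproduct.
Context (R : realType) (I : Type).
Implicit Types X Y : I -> met R.

Definition coprod_dist X (x y : {i & X i}) : \bar R :=
  match pselect (projT1 x = projT1 y) with
  | left e => edist (eq_rect _ X (projT2 x) _ e) (projT2 y)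
  | right _ => +oo
  end.

Lemma coprod_dist_same X i (x y : X i) :
  coprod_dist (existT X i x) (existT X i y) = edist x y.
Proof.
rewrite /coprod_dist /=; case: pselect => // e.
by rewrite (Prop_irrelevance e erefl).
Qed.

Lemma coprod_dist_diff X i j (x : X i) (y : X j) :
  i <> j -> coprod_dist (existT X i x) (existT X j y) = +oo.
Proof. by rewrite /coprod_dist /=; case: pselect. Qed.

Definition coprod_met X : met R.
Proof.
refine (@Met R {i & X i} (@coprod_dist X) _ _ _ _ _).
- move=> [i x] [j y]; have [ij|ij] := pselect (i = j).
    by subst j; rewrite coprod_dist_same edist_ge0.
  by rewrite coprod_dist_diff.
- by move=> [i x]; rewrite coprod_dist_same edist_refl.
- move=> [i x] [j y]; have [ij|ij] := pselect (i = j).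
    by subst j; rewrite coprod_dist_same => /edist_eq0 ->.
  by rewrite coprod_dist_diff.
- move=> [i x] [j y]; have [ij|ij] := pselect (i = j).
    by subst j; rewrite !coprod_dist_same edist_sym.
  by rewrite !coprod_dist_diff// => /esym.
- move=> [j y] [i x] [k z].
  have [ij|ij] := pselect (i = j); last first.
    rewrite (coprod_dist_diff _ _ ij) addye ?leey//.
    have [jk|jk] := pselect (j = k); last by rewrite coprod_dist_diff.
    by subst k; rewrite coprod_dist_same -ltNye (lt_le_trans _ (edist_ge0 _ _)).
  subst j; have [ik|ik] := pselect (i = k); last first.
    rewrite !(coprod_dist_diff _ _ ik) coprod_dist_same addey ?leey//.
    by rewrite -ltNye (lt_le_trans _ (edist_ge0 _ _)).
  by subst k; rewrite !coprod_dist_same edist_tri.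
Defined.

Lemma coprod_inj_nonexp X i (x y : X i) :
  edist (existT X i x : coprod_met X) (existT X i y) <= edist x y.
Proof. by rewrite /= coprod_dist_same. Qed.

Definition coprod_inj X i : met_hom (X i) (coprod_met X) :=
  Hom (@coprod_inj_nonexp X i).

Lemma coprod_universal X (C : met R) (c : forall i, met_hom (X i) C) :
  exists! h : met_hom (coprod_met X) C, forall i, h \oh coprod_inj X i = c i.
Proof.
have ne (x y : coprod_met X) :
    edist (c (projT1 x) (projT2 x)) (c (projT1 y) (projT2 y)) <= edist x y.
  case: x y => [i x] [j y] /=; have [ij|ij] := pselect (i = j).
    by subst j; rewrite coprod_dist_same hom_nonexp.
  by rewrite coprod_dist_diff// leey.
exists (@Hom R (coprod_met X) C (fun x => c (projT1 x) (projT2 x)) ne).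
split => [i|h hc]; first exact: hom_ext.
by apply: hom_ext => -[i x] /=; rewrite -hc.
Qed.

Lemma coprod_map_nonexp X Y (f : forall i, met_hom (X i) (Y i))
    (x y : coprod_met X) :
  edist (existT Y (projT1 x) (f _ (projT2 x)) : coprod_met Y)
        (existT Y (projT1 y) (f _ (projT2 y))) <= edist x y.
Proof.
case: x y => [i x] [j y] /=; have [ij|ij] := pselect (i = j).
  by subst j; rewrite !coprod_dist_same hom_nonexp.
by rewrite !coprod_dist_diff.
Qed.

Definition coprod_functor (F : I -> functor R) : functor R.
Proof.
refine (@Functor R (fun X : met R => coprod_met (fun i => F i X))
  (fun (X Y : met R) (f : met_hom X Y) => Hom (coprod_map_nonexp (fun i => fmap (F i) f))) _ _).
- by move=> X; apply: hom_ext => -[i x]; rewrite /= fmap_id.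
- by move=> X Y Z g f; apply: hom_ext => -[i x]; rewrite /= fmap_comp.
Defined.

End Coproduct.

Inductive hausdorff_polynomial (R : realType) : functor R -> Prop :=
| hp_hausdorff : hausdorff_polynomial (hausdorff_functor R)
| hp_const (A : met R) : hausdorff_polynomial (const_functor A)
| hp_id : hausdorff_polynomial (id_functor R)
| hp_prod (I : Type) (F : I -> functor R) :
    (forall i, hausdorff_polynomial (F i)) ->
    hausdorff_polynomial (prod_functor F)
| hp_coprod (I : Type) (F : I -> functor R) :
    (forall i, hausdorff_polynomial (F i)) ->
    hausdorff_polynomial (coprod_functor F)
| hp_comp (F G : functor R) :
    hausdorff_polynomial F -> hausdorff_polynomial G ->
    hausdorff_polynomial (comp_functor F G).

(* Diagrams V 0 <- V 1 <- V 2 <- ... *)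
Record opchain (R : realType) := OpChain {
  chain_obj :> nat -> met R;
  chain_map : forall n, met_hom (chain_obj n.+1) (chain_obj n) }.

Section Limits.
Context (R : realType).
Implicit Types V : opchain R.

Definition is_cone V (L : met R) (l : forall n, met_hom L (V n)) : Prop :=
  forall n, chain_map V n \oh l n.+1 = l n.

Definition is_limit V (L : met R) (l : forall n, met_hom L (V n)) : Prop :=
  is_cone l /\
  forall (C : met R) (c : forall n, met_hom C (V n)), is_cone c ->
    exists! h : met_hom C L, forall n, l n \oh h = c n.

Definition fmap_chain (F : functor R) V : opchain R :=
  OpChain (fun n => fmap F (chain_map V n)).

Definition thread V := {x : forall n, V n | forall n, chain_map V n (x n.+1) = x n}.

Definition lim_met V : met R.
Proof.
refine (@Met R (thread V) (fun x y => @prod_dist R nat V (sval x) (sval y))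
  _ _ _ _ _).
- by move=> x y; exact: (@edist_ge0 R (prod_met V)).
- by move=> x; exact: (@edist_refl R (prod_met V)).
- move=> [x xP] [y yP] /= /(@edist_eq0 R (prod_met V)) xy; subst y.
  by congr exist; exact: Prop_irrelevance.
- by move=> x y; exact: (@edist_sym R (prod_met V)).
- by move=> y x z; exact: (@edist_tri R (prod_met V)).
Defined.

Definition lim_proj V n : met_hom (lim_met V) (V n) :=
  @Hom R (lim_met V) (V n) (fun x => sval x n)
    (fun x y => prod_dist_ub (sval x) (sval y) n).

Section Lift.
Context V (C : met R) (c : forall n, met_hom C (V n)) (cP : is_cone c).

Lemma lift_thread (x : C) n : chain_map V n (c n.+1 x) = c n x.
Proof. by rewrite -(cP n). Qed.

Definition lift_fun (x : C) : lim_met V := exist _ (fun n => c n x) (lift_thread x).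

Lemma lift_nonexp (x y : C) : edist (lift_fun x) (lift_fun y) <= edist x y.
Proof.
by apply: prod_dist_le => [|n]; [exact: edist_ge0|exact: hom_nonexp].
Qed.

Definition lim_lift : met_hom C (lim_met V) := Hom lift_nonexp.

Lemma lim_liftE n : lim_proj V n \oh lim_lift = c n.
Proof. exact: hom_ext. Qed.

End Lift.

Lemma lim_hom_eq V (C : met R) (f g : met_hom C (lim_met V)) :
  (forall n, lim_proj V n \oh f = lim_proj V n \oh g) -> f = g.
Proof.
move=> fg; apply: hom_ext => x.
have : sval (f x) = sval (g x).
  apply: functional_extensionality_dep => n.
  exact: (congr1 (fun h : met_hom C (V n) => h x) (fg n)).
case: (f x) (g x) => [a aP] [b bP] /= ab; subst b.
by congr exist; exact: Prop_irrelevance.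
Qed.

Lemma lim_is_limit V : is_limit (lim_proj V).
Proof.
split=> [n|C c cP]; first by apply: hom_ext => x /=; exact: (svalP x n).
exists (lim_lift cP); split=> [n|h hc]; first exact: lim_liftE.
by apply: lim_hom_eq => n; rewrite lim_liftE hc.
Qed.

End Limits.

Section AlgebraChain.
Context (R : realType) (F : functor R) (X : met R) (f : met_hom (F X) X).

Fixpoint iter_obj (n : nat) : met R :=
  if n is n'.+1 then F (iter_obj n') else X.

Fixpoint iter_map (n : nat) : met_hom (iter_obj n.+1) (iter_obj n) :=
  if n is n'.+1 then fmap F (iter_map n') else f.

(* X <- F X <- F (F X) <- ..., with connecting maps F^n f *)
Definition iter_chain : opchain R := OpChain iter_map.

Local Notation L := (lim_met iter_chain).
Local Notation l := (lim_proj iter_chain).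

(* the cone F (l n) : F L -> F (iter_obj n) = iter_obj n.+1, completed at 0 *)
Definition iter_cone (n : nat) : met_hom (F L) (iter_chain n) :=
  if n is n'.+1 then fmap F (l n') else f \oh fmap F (l 0%N).

Lemma iter_coneP : is_cone iter_cone.
Proof.
move=> [|n] //=; rewrite -fmap_comp; congr (fmap F _).
exact: (lim_is_limit iter_chain).1.
Qed.

(* the unique morphism k such that l n.+1 \oh k = F (l n) for all n, see
   iter_mediatorE and iter_mediator_unique *)
Definition iter_mediator : met_hom (F L) L := lim_lift iter_coneP.

Lemma iter_mediatorE n : l n.+1 \oh iter_mediator = fmap F (l n).
Proof. exact: (lim_liftE iter_coneP n.+1). Qed.

Lemma iter_mediator_unique (k : met_hom (F L) L) :
  (forall n, l n.+1 \oh k = fmap F (l n)) -> k = iter_mediator.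
Proof.
move=> kE; apply: lim_hom_eq => -[|n]; last by rewrite kE iter_mediatorE.
have eq0 (h : met_hom (F L) L) : l 0%N \oh h = f \oh (l 1%N \oh h).
  by apply: hom_ext => x /=; rewrite (svalP (h x) 0%N).
by rewrite !eq0 kE iter_mediatorE.
Qed.

End AlgebraChain.

Section TerminalChain.
Context (R : realType) (F : functor R).

(* V_n *)
Definition Vfin : opchain R := iter_chain (bang (F (one_met R))).

Definition Vomega : met R := lim_met Vfin.

Definition momega : met_hom (F Vomega) Vomega := iter_mediator (bang (F (one_met R))).

(* V_(omega+n) *)
Definition Vomega_plus : opchain R := iter_chain momega.

(* V_(omega+omega) *)
Definition Vomega2 : met R := lim_met Vomega_plus.

Definition proj_omega2 (n : nat) : met_hom Vomega2 (Vomega_plus n) :=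
  lim_proj Vomega_plus n.

Definition canonical_omega2 : met_hom (F Vomega2) Vomega2 := iter_mediator momega.

Definition preserves_limit (V : opchain R) (L : met R)
    (l : forall n, met_hom L (V n)) : Prop :=
  @is_limit R (fmap_chain F V) (F L) (fun n => fmap F (l n)).

Definition inverse_homs (X Y : met R) (f : met_hom X Y) (g : met_hom Y X) : Prop :=
  g \oh f = idhom X /\ f \oh g = idhom Y.

Definition terminal_coalgebra (C : met R) (c : met_hom C (F C)) : Prop :=
  forall (D : met R) (d : met_hom D (F D)),
    exists! h : met_hom D C, c \oh h = fmap F h \oh d.

End TerminalChain.

(* Main.v *)
(* Call a cone jointly isometric when its source carries the supremum of the
   distances of its components.  A Hausdorff polynomial functor F preserves
   jointly isometric cones of omega^op-chains (for the Hausdorff functor by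
   compactness, choosing a cluster point of nearly optimal points), hence also
   isometric embeddings.  Thus m : F V_omega -> V_omega is an isometric
   embedding, and so are all connecting maps F^n m.  On chains of isometric
   embeddings F preserves limits: for the Hausdorff functor, a thread of compact
   sets is determined by its first member, all of whose points lift to the
   limit.  Terminality holds because unique solvability of h = f \o F h \o d,
   trivial for f : F 1 -> 1, passes to the limit of the chain f, F f, F (F f)... *)
From mathcomp Require Import all_boot all_order all_algebra.
From mathcomp Require Import all_classical all_reals.
From mathcomp Require Import ereal topology.
Require Import Defs.

Set Implicit Arguments.
Unset Strict Implicit.
Unset Printing Implicit Defensive.

Import Order.TTheory GRing.Theory Num.Theory.

Local Open Scope classical_set_scope.
Local Open Scope ring_scope.
Local Open Scope ereal_scope.

(** * Isometries, jointly isometric cones and a pointwise criterion for limits *)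

Section Isometries.
Context (R : realType).
Implicit Types X Y L : met R.

Definition isometry X Y (f : met_hom X Y) : Prop :=
  forall x y, edist (f x) (f y) = edist x y.

Lemma isometry_inj X Y (f : met_hom X Y) : isometry f -> injective f.
Proof.
by move=> fI x y fxy; apply: edist_eq0; rewrite -fI fxy edist_refl.
Qed.

(** A filter on [S] pushes forward to one on the image, which clusters at some [f x] with [x] in
    [S]; since [f] reflects balls, the original filter clusters at [x]. *)
Lemma isometry_compact X Y (f : met_hom X Y) (S : set X) :
  isometry f -> compact (f @` S) -> compact S.
Proof.
move=> fI cfS G GF GS.
have [|_ [[x Sx <-] fGx]] := cfS (f @ G) _ _.
  by rewrite nbhs_filterE /=; apply: (@filterS _ G _ S) => // x Sx; exists x.
exists x; split=> // A B GA /nbhs_ballP[e e0 eB].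
have [||_ [[a Aa <-] xa]] := fGx (f @` A) (ball (f x) e).
- by rewrite nbhs_filterE /=; apply: (@filterS _ G _ A) => // a Aa; exists a.
- exact: nbhsx_ballx.
exists a; split=> //; apply: eB.
by move: xa; rewrite /ball /= /met_ball /= fI.
Qed.

(** Quantifying over upper bounds [M] avoids suprema; the reverse inequality is non-expansion. *)
Definition jointly_isometric (V : opchain R) L (l : forall n, met_hom L (V n)) :=
  forall x y (M : \bar R),
    (forall n, edist (l n x) (l n y) <= M) -> edist x y <= M.

Definition covers_threads (V : opchain R) L (l : forall n, met_hom L (V n)) :=
  forall t : (forall n, V n), (forall n, chain_map V n (t n.+1) = t n) ->
    exists x, forall n, l n x = t n.

Lemma jointly_isometric_inj (V : opchain R) L (l : forall n, met_hom L (V n)) x y :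
  jointly_isometric l -> (forall n, l n x = l n y) -> x = y.
Proof.
move=> lI lxy; apply: edist_eq0; apply/le_anti; rewrite edist_ge0 andbT.
by apply: lI => n; rewrite lxy edist_refl.
Qed.

Lemma cone_mapE (V : opchain R) L (l : forall n, met_hom L (V n)) :
  is_cone l -> forall n x, chain_map V n (l n.+1 x) = l n x.
Proof. by move=> lC n x; rewrite -(lC n). Qed.

Lemma cone_dist_mono (V : opchain R) L (l : forall n, met_hom L (V n)) :
  is_cone l -> forall m n x y, (n <= m)%N ->
  edist (l n x) (l n y) <= edist (l m x) (l m y).
Proof.
move=> lC m n x y; elim: m => [|m IH]; first by rewrite leqn0 => /eqP ->.
rewrite leq_eqVlt => /predU1P[->//|/IH/le_trans]; apply.
by rewrite -(cone_mapE lC m x) -(cone_mapE lC m y) hom_nonexp.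
Qed.

Lemma fmap_cone (F : functor R) (V : opchain R) L (l : forall n, met_hom L (V n)) :
  is_cone l -> @is_cone R (fmap_chain F V) _ (fun n => fmap F (l n)).
Proof. by move=> lC n /=; rewrite -fmap_comp lC. Qed.

Lemma is_limitP (V : opchain R) L (l : forall n, met_hom L (V n)) :
  is_cone l -> jointly_isometric l -> covers_threads l -> is_limit l.
Proof.
move=> lC lI lT; split=> // C c cC.
have /choice[h hE] (z : C) : exists x, forall n, l n x = c n z.
  by apply: lT => n; exact: cone_mapE.
have hN x y : edist (h x) (h y) <= edist x y.
  by apply: lI => n; rewrite !hE hom_nonexp.
exists (Hom hN); split=> [n|k kE]; first by apply: hom_ext => x /=; exact: hE.
apply: hom_ext => x /=; apply: (jointly_isometric_inj lI) => n.
by rewrite hE -kE.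
Qed.

Lemma lim_jointly_isometric (V : opchain R) : jointly_isometric (lim_proj V).
Proof.
move=> x y M xyM; apply: prod_dist_le => //.
exact: le_trans (edist_ge0 _ _) (xyM 0%N).
Qed.

Lemma lim_covers_threads (V : opchain R) : covers_threads (lim_proj V).
Proof. by move=> t tP; exists (exist _ t tP). Qed.

End Isometries.

(** * The properties propagated by induction on polynomials, and their closure under the
    constructions *)

Section GoodFunctors.
Context (R : realType).

Record good (F : functor R) : Prop := Good {
  good_isometric : forall (V : opchain R) (L : met R)
    (l : forall n, met_hom L (V n)), is_cone l -> jointly_isometric l ->
    @jointly_isometric R (fmap_chain F V) _ (fun n => fmap F (l n));
  good_covers : forall (V : opchain R) (L : met R)
    (l : forall n, met_hom L (V n)), is_cone l -> jointly_isometric l ->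
    (forall n, isometry (chain_map V n)) -> covers_threads l ->
    @covers_threads R (fmap_chain F V) _ (fun n => fmap F (l n)) }.

(* An isometry is a jointly isometric cone over a constant chain. *)
Lemma good_isometry (F : functor R) (X Y : met R) (f : met_hom X Y) :
  good F -> isometry f -> isometry (fmap F f).
Proof.
move=> Fg fI x y; apply/le_anti; rewrite hom_nonexp /=.
pose V := OpChain (fun n : nat => idhom Y).
apply: (@good_isometric F Fg V X (fun=> f)) => // [n|a b M /(_ 0%N)].
  exact: hom_ext.
by rewrite fI.
Qed.

Lemma good_const (A : met R) : good (const_functor A).
Proof.
split=> [V L l _ _ x y M /(_ 0%N)//|V L l _ _ _ _ t tP].
by exists (t 0%N); elim=> [//|n IH]; rewrite /= in IH *; rewrite IH -tP.
Qed.

Lemma good_id : good (id_functor R).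
Proof. by split. Qed.

(** [F] is applied to the image under [G] of the chain, whose connecting maps are again isometries
    because [G] preserves these. *)
Lemma good_comp (F G : functor R) : good F -> good G -> good (comp_functor F G).
Proof.
move=> Fg Gg; split=> [V L l lC lI|V L l lC lI VI lT].
  apply: (good_isometric Fg (fmap_cone G lC)); exact: good_isometric.
apply: (good_covers Fg (fmap_cone G lC)).
- exact: good_isometric.
- by move=> n; exact: good_isometry.
- exact: good_covers.
Qed.

Lemma good_prod (I : Type) (F : I -> functor R) :
  (forall i, good (F i)) -> good (prod_functor F).
Proof.
move=> Fg; split=> [V L l lC lI x y M xyM|V L l lC lI VI lT t tP].
  apply: prod_dist_le => [|i]; first exact: le_trans (edist_ge0 _ _) (xyM 0%N).
  apply: (good_isometric (Fg i) lC lI) => n; apply: le_trans (xyM n).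
  exact: (prod_dist_ub (fmap (prod_functor F) (l n) x) _ i).
have ex i : exists x : F i L, forall n, fmap (F i) (l n) x = t n i.
  apply: (good_covers (Fg i) lC lI VI lT (t := fun n => t n i)) => n.
  exact: (congr1 (fun z : prod_met (fun i => F i (V n)) => z i) (tP n)).
exists (fun i => sval (cid (ex i))) => n.
by apply: functional_extensionality_dep => i /=; case: cid.
Qed.

Lemma good_coprod (I : Type) (F : I -> functor R) :
  (forall i, good (F i)) -> good (coprod_functor F).
Proof.
move=> Fg; split=> [V L l lC lI [i x] [j y] M xyM|V L l lC lI VI lT t tP].
  have [ij|ij] := pselect (i = j); last first.
    by have := xyM 0%N; rewrite /= !coprod_dist_diff.
  subst j; rewrite /= coprod_dist_same.
  by apply: (good_isometric (Fg i) lC lI) => n; have := xyM n;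
    rewrite /= coprod_dist_same.
(* Connecting maps preserve the index, so a thread stays in the summand of its first member. *)
pose i := projT1 (t 0%N).
have idx n : projT1 (t n) = i by elim: n => [//|n <-]; rewrite -(tP n).
have ex n : exists u : F i (V n), t n = existT (fun i => F i (V n)) i u.
  by move: (t n) (idx n) => [j u] /= <-; exists u.
pose u n := sval (cid (ex n)).
have uE n : t n = existT (fun i => F i (V n)) i (u n) by rewrite /u; case: cid.
have [x xE] : exists x : F i L, forall n, fmap (F i) (l n) x = u n.
  apply: (good_covers (Fg i) lC lI VI lT) => n; apply: edist_eq0.
  (* Zero distance in the coproduct replaces injectivity of dependent pairs. *)
  rewrite -(@coprod_dist_same R I (fun i => F i (V n))) -uE -(tP n) (uE n.+1).
  exact: (edist_refl (m := coprod_met (fun i => F i (V n)))).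
by exists (existT (fun i => F i L) i x) => n; rewrite uE -xE.
Qed.

End GoodFunctors.

(** * The Hausdorff functor: approximation by compactness and lifting of threads *)

Section HausdorffGood.
Context (R : realType) (V : opchain R) (L : met R).
Context (l : forall n, met_hom L (V n)).
Hypothesis lC : is_cone l.
Hypothesis lI : jointly_isometric l.

Lemma excess_jointly_isometric (S T : set L) (M : \bar R) : compact T ->
  (forall n, excess (l n @` S) (l n @` T) <= M) -> excess S T <= M.
Proof.
move=> cT STM.
have M0 : 0 <= M by apply: le_trans (STM 0%N); exact: excess_ge0.
have [->|Mfin] := eqVneq M +oo; first exact: leey.
have {}Mfin : M \is a fin_num by rewrite ge0_fin_numE// ltey.
apply: excess_le => // x Sx; apply/lee_addgt0Pr => e e0.
have e20 : (0 < e / 2)%R by rewrite divr_gt0.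
(* [y n] is nearly optimal for [x] at level [n]; a cluster point [z] in [T] of this sequence will
   serve at all levels. *)
have /choice[y yP] n : exists y, T y /\ edist (l n x) (l n y) < M + (e / 2)%:E.
  have /ereal_inf_lt[_ [_ [y Ty <-] <-] xy] :
      ereal_inf [set edist (l n x) z | z in l n @` T] < M + (e / 2)%:E.
    apply: (@le_lt_trans _ _ M); last by rewrite lteDl.
    by apply: le_trans (STM n); apply: inf_dist_le; exists x.
  by exists y.
have [|z [Tz yz]] := cT (y @ \oo) _ _.
  by exists 0%N => // n _; exact: (yP n).1.
apply: (@le_trans _ _ (edist x z)); first by apply: ereal_inf_lbound; exists z.
apply: lI => n.
(* Some [y m] with [m] at least [n] is close to [z]; its bound at level [m] descends to level [n],
   as distances only shrink down the chain. *)
have [||_ [[m /= nm <-] zm]] := yz (y @` [set m | (n <= m)%N]) (ball z (e / 2)).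
- by exists n => // m /= nm; exists m.
- exact: nbhsx_ballx.
apply: le_trans (edist_tri (l n (y m)) _ _) _.
rewrite [e]splitr EFinD addeA; apply: leeD.
  exact: le_trans (cone_dist_mono lC _ _ nm) (ltW (yP m).2).
apply: le_trans (hom_nonexp _ _ _) _; rewrite edist_sym; exact: ltW.
Qed.

Lemma chain_isometry_proj : (forall n, isometry (chain_map V n)) -> isometry (l 0%N).
Proof.
move=> VI x y; apply/le_anti; rewrite hom_nonexp /=; apply: lI.
by elim=> // n; rewrite -(cone_mapE lC n x) -(cone_mapE lC n y) VI.
Qed.

(** The witness is the preimage of the first compact set under [l 0], which is an isometry, so
    compactness transfers. Injectivity of the connecting maps forces the images at higher levels. *)
Lemma hausdorff_covers_threads : (forall n, isometry (chain_map V n)) ->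
  covers_threads l ->
  @covers_threads R (fmap_chain (hausdorff_functor R) V) _
    (fun n => fmap (hausdorff_functor R) (l n)).
Proof.
move=> VI lT t tP.
pose T n : set (V n) := sval (t n).
have TE n : chain_map V n @` T n.+1 = T n by rewrite /T -[in RHS]tP.
have lift n (s : {v : V n | T n v}) :
    {w : {v : V n.+1 | T n.+1 v} | chain_map V n (sval w) = sval s}.
  case: s => v Tv /=; apply: cid; move: Tv; rewrite -TE => -[w Tw <-].
  by exists (exist _ w Tw).
pose S : set L := l 0%N @^-1` T 0%N.
have S0 v : T 0%N v -> exists2 x, S x & l 0%N x = v.
  move=> Tv.
  (* Successive choice of preimages inside the sets [T n] gives a thread of points starting at
     [v]. *)
  pose s := fix s n : {v : V n | T n v} :=
    if n is n'.+1 then sval (lift n' (s n')) else exist _ v Tv.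
  have [n|x xE] := lT (fun n => sval (s n)).
    by rewrite /=; case: (lift n (s n)).
  by exists x; rewrite ?/S /preimage /= xE.
have cS : compact S.
  apply: (isometry_compact (chain_isometry_proj VI)).
  suff -> : l 0%N @` S = T 0%N by exact: (svalP (t 0%N)).
  by apply/seteqP; split=> [_ [x Sx <-]//|v /S0[x Sx <-]]; exists x.
exists (exist _ S cS) => n; apply: compacts_eq => /=.
change (l n @` S = T n); elim: n => [|n IH].
  by apply/seteqP; split=> [_ [x Sx <-]//|v /S0[x Sx <-]]; exists x.
apply/seteqP; split=> [_ [x Sx <-]|w Tw].
  have : T n (l n x) by rewrite -IH; exists x.
  rewrite -TE -(cone_mapE lC) => -[w Tw /(isometry_inj (VI n)) <-//].
have : T n (chain_map V n w) by rewrite -TE; exists w.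
rewrite -IH => -[x Sx]; rewrite -(cone_mapE lC) => /(isometry_inj (VI n)) <-.
by exists x.
Qed.

End HausdorffGood.

Lemma good_hausdorff (R : realType) : good (hausdorff_functor R).
Proof.
split=> [V L l lC lI S T M STM|]; last exact: hausdorff_covers_threads.
rewrite /= /hausdorff_dist ge_max; apply/andP; split.
  apply: (excess_jointly_isometric lC lI) => [|n]; first exact: svalP.
  by apply: le_trans (STM n); rewrite /= /hausdorff_dist le_max lexx.
apply: (excess_jointly_isometric lC lI) => [|n]; first exact: svalP.
by apply: le_trans (STM n); rewrite /= /hausdorff_dist le_max lexx orbT.
Qed.

Lemma hausdorff_polynomial_good (R : realType) (F : functor R) :
  hausdorff_polynomial F -> good F.
Proof.
elim=> {F} [|A||I F _|I F _|F G _ Fg _ Gg].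
- exact: good_hausdorff.
- exact: good_const.
- exact: good_id.
- exact: good_prod.
- exact: good_coprod.
- exact: good_comp.
Qed.

(** * Passing from an algebra to the limit of its iterated chain *)

Section Iteration.
Context (R : realType) (F : functor R) (X : met R) (f : met_hom (F X) X).

Local Notation L := (lim_met (iter_chain f)).
Local Notation l := (lim_proj (iter_chain f)).
Local Notation k := (iter_mediator f).

Lemma iter_lim_eq (x y : L) : (forall n, l n.+1 x = l n.+1 y) -> x = y.
Proof.
move=> xy; have lC := cone_mapE (lim_is_limit (iter_chain f)).1.
apply: (jointly_isometric_inj (@lim_jointly_isometric _ _)) => -[|//].
by rewrite -(lC 0%N x) -(lC 0%N y) xy.
Qed.

(** The distance of [k x] and [k y] bounds that of their images under each [fmap F (l n)], and these
    maps form a jointly isometric cone. Here [f] itself may be any algebra. *)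
Lemma iter_mediator_isometry : good F -> isometry k.
Proof.
move=> Fg x y; apply/le_anti; rewrite hom_nonexp /=.
apply: (good_isometric Fg (lim_is_limit (iter_chain f)).1 (@lim_jointly_isometric _ _)).
by move=> n; rewrite -(iter_mediatorE f n); exact: (hom_nonexp (l n.+1)).
Qed.

Lemma iter_map_isometry : good F -> isometry f -> forall n, isometry (iter_map f n).
Proof. by move=> Fg fI; elim=> //= n IH; exact: good_isometry. Qed.

Lemma iter_preserves : good F -> isometry f -> preserves_limit F l.
Proof.
move=> Fg fI; have lC := (lim_is_limit (iter_chain f)).1.
have lI := @lim_jointly_isometric _ (iter_chain f).
apply: is_limitP; first exact: fmap_cone.
- exact: good_isometric.
- apply: (good_covers Fg lC lI); first exact: iter_map_isometry.
  exact: lim_covers_threads.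
Qed.

Lemma iter_mediator_inverse : good F -> isometry f ->
  exists g : met_hom L (F L), inverse_homs k g.
Proof.
move=> Fg fI; have lC := (lim_is_limit (iter_chain f)).1.
have lI := @lim_jointly_isometric _ (iter_chain f).
have kI := iter_mediator_isometry Fg.
have /choice[g gE] (y : L) : exists x, k x = y.
  (* Dropping the component of [y] at 0 leaves a thread of the chain obtained by applying [F]. *)
  have [||n|x xE] := good_covers Fg lC lI _ _ (t := fun n => l n.+1 y).
  - exact: iter_map_isometry.
  - exact: lim_covers_threads.
  - exact: (cone_mapE lC n.+1).
  by exists x; apply: iter_lim_eq => n; rewrite -xE -iter_mediatorE.
have gN x y : edist (g x) (g y) <= edist x y by rewrite -kI !gE.
exists (Hom gN); split; apply: hom_ext => x /=; last exact: gE.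
by apply: (isometry_inj kI); rewrite gE.
Qed.

(** Terminality rephrased for an algebra, so that it makes sense before the structure is known to be
    invertible. *)
Definition corecursive (Y : met R) (a : met_hom (F Y) Y) : Prop :=
  forall (D : met R) (d : met_hom D (F D)),
    exists! h : met_hom D Y, h = a \oh (fmap F h \oh d).

Lemma comp_homA (A B C D : met R) (h : met_hom C D) (g : met_hom B C)
  (e : met_hom A B) : h \oh (g \oh e) = h \oh g \oh e.
Proof. exact: hom_ext. Qed.

(** The solution for [f] starts a recursion whose values form a cone, and its lift solves the
    equation for [k]. The components of any other solution obey the same recursion. *)
Lemma iter_mediator_corecursive : corecursive f -> corecursive k.
Proof.
move=> fc D d; have [c0 [c0E c0U]] := fc D d.
pose c := fix c n : met_hom D (iter_chain f n) :=
  if n is n'.+1 then fmap F (c n') \oh d else c0.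
have lC := (lim_is_limit (iter_chain f)).1.
have cC : is_cone c.
  elim=> [|n IH] /=; first by rewrite -c0E.
  by rewrite comp_homA -fmap_comp IH.
exists (lim_lift cC); split=> [|h hE].
  apply: hom_ext => x; apply: iter_lim_eq => n.
  have e : l n.+1 \oh k \oh (fmap F (lim_lift cC) \oh d) = c n.+1.
    by rewrite iter_mediatorE comp_homA -fmap_comp lim_liftE.
  exact: esym (congr1 (fun h : met_hom D _ => h x) e).
have hS n : l n.+1 \oh h = fmap F (l n \oh h) \oh d.
  by rewrite {1}hE comp_homA iter_mediatorE comp_homA -fmap_comp.
apply: lim_hom_eq; elim=> [|n IH]; rewrite lim_liftE; last first.
  by rewrite hS -IH lim_liftE.
(* As [l 0] is [f] after [l 1], the component of [h] at 0 solves the equation for [f]. *)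
apply: c0U; rewrite -[LHS](congr1 (fun e => e \oh h) (lC 0%N)) -comp_homA.
exact: (congr1 (fun e : met_hom D (F X) => f \oh e) (hS 0%N)).
Qed.

End Iteration.

(** * Terminality, and the two limit steps combined *)

Lemma bang_corecursive (R : realType) (F : functor R) :
  corecursive (bang (F (one_met R))).
Proof.
move=> D d; exists (bang D); split=> [|h _]; by rewrite [RHS]bang_unique.
Qed.

Lemma corecursive_terminal (R : realType) (F : functor R) (C : met R)
    (a : met_hom (F C) C) (g : met_hom C (F C)) :
  inverse_homs a g -> corecursive a -> terminal_coalgebra g.
Proof.
move=> [ga ag] ac D d; have [h [hE hU]] := ac D d.
have id_l X Y (e : met_hom X Y) : idhom Y \oh e = e by exact: hom_ext.
exists h; split=> [|h' h'E]; first by rewrite {1}hE comp_homA ga id_l.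
by apply: hU; rewrite -h'E comp_homA ag id_l.
Qed.

Theorem theorem5p9 (R : realType) (F : functor R) (hF : hausdorff_polynomial F) :
  preserves_limit F (proj_omega2 F) /\
  exists g : met_hom (Vomega2 F) (F (Vomega2 F)),
    inverse_homs (canonical_omega2 F) g /\ terminal_coalgebra g.
Proof.
have Fg := hausdorff_polynomial_good hF.
(* The first limit supplies an isometric algebra; the second, built on it, is preserved by [F]. *)
have mI : isometry (momega F) by exact: iter_mediator_isometry.
split; first exact: iter_preserves.
have [g gP] := iter_mediator_inverse Fg mI.
exists g; split=> //; apply: (corecursive_terminal gP).
(* Corecursiveness passes from [F 1 -> 1] to [momega], then to the canonical morphism. *)
by do 2![apply: iter_mediator_corecursive]; exact: bang_corecursive.
Qed.
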